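(* Let $p$ be a prime and let $k<8$ be a positive integer. Then every finite abelian reflexive ring of order $p^k$ is reversible.
   Context: All rings are associative with identity $1\neq 0$, not necessarily commutative. A ring $R$ is abelian if each idempotent of $R$ is central. A ring $R$ is reflexive if for all $a,b\in R$, $aRb=0$ implies $bRa=0$. A ring $R$ is reversible if for all $a,b\in R$, $ab=0$ implies $ba=0$. *)

(* Defs.v *)
From HB Require Import structures.
From mathcomp Require Import all_boot all_order all_algebra.

Set Implicit Arguments.
Unset Strict Implicit.
Unset Printing Implicit Defensive.

Import GRing.Theory.
Local Open Scope ring_scope.

Definition abelian_ring (R : nzRingType) : Prop :=
  forall e : R, e * e = e -> forall r : R, e * r = r * e.

(* [a R b = 0] says that every product [a * r * b] vanishes. *)
Definition reflexive_ring (R : nzRingType) : Prop :=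
  forall a b : R,
    (forall r : R, a * r * b = 0) -> (forall r : R, b * r * a = 0).

Definition reversible_ring (R : nzRingType) : Prop :=
  forall a b : R, a * b = 0 -> b * a = 0.

(* Main.v *)
Require Import Defs.
From HB Require Import structures.
From mathcomp Require Import all_boot all_order all_algebra.
From mathcomp Require Import all_fingroup all_solvable.
From mathcomp Require Import zify.

(** The central idempotents cut a finite abelian ring into corners e R that have
    no idempotent besides 0 and e; there each element is nilpotent or a unit.
    So let R be local, with maximal ideal J (the nilpotent elements), and let
    a b = 0 while b a <> 0. The claim is that R has at least p ^ 8 elements.

    The count goes by exhibiting eight elements that admit no linear relation
    with coefficients that are integers smaller than p in absolute value: then
    the p ^ 8 combinations with coefficients in [0, p) are distinct. Such an
    integer, if it is not 0, is invertible in R, because a power of p is 0.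
    A relation is refuted by multiplying it on both sides by elements that
    annihilate all its terms but one.

    If the residue field is not F_p, some r is congruent to no integer modulo J,
    and the p ^ 2 elements n + m r are pairwise incongruent. Four elements that
    are independent over these coefficients suffice, and 1, a, b, b a will do
    unless b = w a is a multiple of a; then 1, a, a a, w a a (when w is in J) or
    1, a, a w, a a (when w is a unit) will
    (lemma [large_residue_field_reversible]).

    If R = Z + J, reflexivity turns b a <> 0 into a c b <> 0 for some c in J.
    Choosing b and then c as deep as possible in the radical makes b J a,
    a J c b and a c J b vanish; reflexivity then makes a c b, b a c and c b a
    nonzero elements annihilated by J (lemma [nonreversible_cyclic_triple]).
    Generically the eight elements are 1, a, b, c, b a, a c, c b, a c b.
    A relation between them can only involve a, b, b a, a c, c b, a c b.
    - If b occurs, then a does not, a c a c <> 0, and 1, a, c, a c, c a, b a,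
      c b, a c b are independent ([relation_involving_b]).
    - If a occurs, the same applies to the converse ring, in which the triple
      (b, a, c) has the properties of (a, b, c).
    - If neither occurs, then a a c, c b b and b c b are nonzero, and 1, a, b,
      c, b a, c b, b c, a c b are independent ([relation_of_products]).
    Lemma [no_cyclic_triple] combines the three cases. *)

Set Implicit Arguments.
Unset Strict Implicit.
Unset Printing Implicit Defensive.

Import GRing.Theory.
Local Open Scope ring_scope.

(** * Nilpotent elements and local rings *)

Definition nilp (R : nzRingType) (x : R) : Prop := exists n, x ^+ n = 0.

Lemma nilp_converse (R : nzRingType) (x : R) : nilp (x : R^c) <-> nilp x.
Proof.
have E n : ((x : R^c) ^+ n : R) = x ^+ n.
  by elim: n => [|n IHn] //; rewrite exprS exprSr -IHn.
by split=> -[n xn]; exists n; [rewrite -E | rewrite E].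
Qed.

(** The powers of x repeat: they are periodic, of period d say, from some
    exponent i on, and a multiple n > i of d works. *)
Lemma expr_idempotent (R : finNzRingType) (x : R) :
  exists2 n, (0 < n)%N & x ^+ n * x ^+ n = x ^+ n.
Proof.
have /injectivePn[i [j ij Exij]] :
    ~~ injectiveb (fun i : 'I_#|R|.+1 => x ^+ i).
  by apply/negP => /injectiveP /leq_card; rewrite card_ord ltnn.
wlog ltij : i j ij Exij / (i < j)%N.
  move=> wl; case: (ltngtP i j) => [|ji|/val_inj Eij].
  - exact: wl.
  - by apply: (wl j i) => //; rewrite eq_sym.
  - by rewrite Eij eqxx in ij.
pose d := (j - i)%N.
have per k m : (i <= m)%N -> x ^+ (m + d * k) = x ^+ m.
  move=> im; elim: k => [|k IHk]; first by rewrite muln0 addn0.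
  rewrite mulnS addnA -[in RHS]IHk.
  have -> : (m + d + d * k = (m - i + d * k) + j)%N by rewrite /d; lia.
  have -> : (m + d * k = (m - i + d * k) + i)%N by rewrite /d; lia.
  by rewrite !exprD Exij.
have d_gt0 : (0 < d)%N by rewrite subn_gt0.
exists (d * i.+1)%N; first by rewrite muln_gt0 d_gt0.
by rewrite -exprD per //; apply: leq_trans (leqnSn i) (leq_pmull _ d_gt0).
Qed.

(** Iterating the equation gives y = j ^+ n * y * r ^+ n for all n. *)
Lemma nilp_sandwich_eq0 (R : nzRingType) (j r y : R) :
  nilp j -> y = j * y * r -> y = 0.
Proof.
move=> [n jn] E; have : y = j ^+ n * y * r ^+ n.
  elim: n {jn} => [|n IHn]; first by rewrite mul1r mulr1.
  by rewrite {1}IHn {1}E exprSr exprS !mulrA.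
by rewrite jn !mul0r.
Qed.

Lemma nilp_sandwich_eq0r (R : nzRingType) (j r y : R) :
  nilp j -> y = r * y * j -> y = 0.
Proof.
move=> /nilp_converse nj E; apply: (@nilp_sandwich_eq0 R^c j r y nj).
by rewrite [LHS]E -mulrA.
Qed.

Lemma not_nilp1 (R : nzRingType) : ~ nilp (1 : R).
Proof. by case=> n /eqP; rewrite expr1n oner_eq0. Qed.

(** A unit plus an element of the radical does not divide 0: multiplying by u
    turns the equation into y = - (u * j) * y. *)
Lemma unit_add_nilp_regular (R : nzRingType) (u t j y : R) :
  u * t = 1 -> nilp (u * j) -> t * y + j * y = 0 -> y = 0.
Proof.
move=> ut nuj E; apply: (nilp_sandwich_eq0 (r := -1) nuj).
apply/eqP; rewrite mulrN1 -subr_eq0 opprK.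
by rewrite -[X in X + _]mul1r -ut -!mulrA -mulrDr E mulr0.
Qed.

Definition local_ring (R : nzRingType) : Prop :=
  forall x : R, nilp x \/ exists2 y : R, y * x = 1 & x * y = 1.

(** Some power of x is idempotent, hence 0 or 1. *)
Lemma idempotent_trivial_local (R : finNzRingType) :
  (forall e : R, e * e = e -> e = 0 \/ e = 1) -> local_ring R.
Proof.
move=> idR x; have [n n_gt0 /idR[xn0|xn1]] := expr_idempotent x.
  by left; exists n.
by right; exists (x ^+ n.-1); rewrite -?exprS -?exprSr prednK.
Qed.

Section Local.

Variable R : nzRingType.
Hypothesis locR : local_ring R.
Implicit Types a b c x y : R.

(** Were r * x not nilpotent, it would be a unit, so x would have a left inverse
    s, and 1 = s * 1 * x would give 1 = 0. *)
Lemma local_nilpMl x r : nilp x -> nilp (r * x).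
Proof.
move=> nx; have [//|[y yrx _]] := locR (r * x).
have := @nilp_sandwich_eq0r _ x (y * r) 1 nx.
by rewrite mulr1 -mulrA yrx => /(_ erefl)/eqP; rewrite oner_eq0.
Qed.

Lemma local_nilpMr x r : nilp x -> nilp (x * r).
Proof.
move=> nx; have [//|[y _ xry]] := locR (x * r).
have := @nilp_sandwich_eq0 _ x (r * y) 1 nx.
by rewrite mulr1 mulrA xry => /(_ erefl)/eqP; rewrite oner_eq0.
Qed.

Lemma zero_divisor_nilp a b : a * b = 0 -> b * a <> 0 -> nilp a /\ nilp b.
Proof.
move=> ab ba; split.
  have [//|[y ya _]] := locR a; case: ba.
  by rewrite -[b]mul1r -ya -[y * a * b]mulrA ab mulr0 mul0r.
have [//|[y _ by1]] := locR b; case: ba.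
by rewrite -[a]mulr1 -by1 [a * _]mulrA ab mul0r mulr0.
Qed.

End Local.

(** * Relations with small integer coefficients *)

Definition small (p : nat) (z : int) : bool := (`|z| < p)%N.

Definition small_regular (p : nat) (V : zmodType) : Prop :=
  forall (x : V) z, small p z -> z != 0 -> x *~ z = 0 -> x = 0.

(** The bound #|V| < p ^ 8 enters the argument only through this property, which
    speaks of the additive group alone: a ring and its converse share it. *)
Definition dependent8 (p : nat) (V : zmodType) : Prop :=
  forall e0 e1 e2 e3 e4 e5 e6 e7 : V,
  exists z0 z1 z2 z3 z4 z5 z6 z7 : int,
  [/\ all (small p) [:: z0; z1; z2; z3; z4; z5; z6; z7],
      has (predC1 0) [:: z0; z1; z2; z3; z4; z5; z6; z7] &
      e0 *~ z0 + e1 *~ z1 + e2 *~ z2 + e3 *~ z3 +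
      e4 *~ z4 + e5 *~ z5 + e6 *~ z6 + e7 *~ z7 = 0].

(** Bezout: z is prime to p ^ k, which is 0 in R. *)
Lemma coprime_int_inv p k (R : nzRingType) (z : int) :
  prime p -> (p ^ k)%:R = 0 :> R -> small p z -> z != 0 ->
  exists u : int, (u * z)%:~R = 1 :> R.
Proof.
move=> p_pr pk0 sz z0.
have cop : coprimez z (p ^ k)%N.
  rewrite /coprimez /gcdz /= eqz_nat -/(coprime _ _) coprimeXr //.
  by rewrite coprime_sym prime_coprime // gtnNdvd // absz_gt0.
case: (Bezoutz z (p ^ k)%N) => u [v E]; exists u.
rewrite (eqP cop) in E.
have := congr1 (fun m : int => m%:~R : R) E.
by rewrite intrD (intrM _ v) -(pmulrn 1 (p ^ k)%N) pk0 mulr0 addr0.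
Qed.

Lemma small_regular_prime_power p k (R : nzRingType) :
  prime p -> (p ^ k)%:R = 0 :> R -> small_regular p R.
Proof.
move=> p_pr pk0 x z sz z0 xz.
have [u uz] := coprime_int_inv p_pr pk0 sz z0.
by rewrite -[x]mulr1 -uz mulrC mulrzAr mulr1 mulrzA xz mul0rz.
Qed.

(** Pigeonhole: two of the p ^ 8 combinations with coefficients in [0, p)
    coincide, and their difference is a relation. *)
Lemma card_lt_dependent8 p (V : finZmodType) :
  (0 < p)%N -> (#|V| < p ^ 8)%N -> dependent8 p V.
Proof.
move=> p_gt0 cardV e0 e1 e2 e3 e4 e5 e6 e7.
pose e := [:: e0; e1; e2; e3; e4; e5; e6; e7].
pose phi (f : {ffun 'I_8 -> 'I_p}) : V := \sum_(i < 8) e`_i *+ f i.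
have /injectivePn[f [g fg phifg]] : ~~ injectiveb phi.
  apply/negP => /injectiveP /leq_card.
  by rewrite card_ffun !card_ord leqNgt cardV.
pose z i : int := (f i)%:Z - (g i)%:Z.
have sz i : small p (z i).
  by rewrite /small /z; have := ltn_ord (f i); have := ltn_ord (g i); lia.
pose o (i : nat) : 'I_8 := inord i.
exists (z (o 0)), (z (o 1)), (z (o 2)), (z (o 3)),
       (z (o 4)), (z (o 5)), (z (o 6)), (z (o 7)); split.
- by rewrite /= !sz.
- apply: contraR fg => /hasPn N; apply/eqP/ffunP => i; apply/val_inj/eqP.
  have : z (o i) \notin predC1 0.
    apply: N.
    rewrite -[[:: _; _; _; _; _; _; _; _]]/(map (fun j => z (o j)) (iota 0 8)).
    by apply/mapP; exists (val i); rewrite ?mem_iota //=.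
  by rewrite inE negbK /z /o inord_val subr_eq0.
- have : \sum_(i < 8) e`_i *~ z (o i) = 0.
    transitivity (phi f - phi g); last by rewrite phifg subrr.
    rewrite /phi -sumrB; apply: eq_bigr => i _.
    by rewrite /o inord_val /z mulrzBr !pmulrn.
  by rewrite !big_ord_recr big_ord0 /= add0r.
Qed.

(** * Residue fields with more than p elements *)

Section LargeResidueField.

Variables (p k : nat) (R : nzRingType) (r : R).
Hypothesis locR : local_ring R.
Hypothesis p_pr : prime p.
Hypothesis pk0 : (p ^ k)%:R = 0 :> R.
Hypothesis dep : dependent8 p R.
Hypothesis r_gen : forall z : int, ~ nilp (r - z%:~R).

Let zero_or_unit (t : R) := t = 0 \/ exists u, u * t = 1.

(** The coefficients are n + m r with n and m small. Such an element is a unit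
    unless n = m = 0: if m is not 0, multiplying by the inverse of m turns it
    into r minus an integer. Hence a relation between the eight elements e_i and
    r e_i is a relation between the four e_i over these coefficients. *)
Let dependent4 (e0 e1 e2 e3 : R) : exists t0 t1 t2 t3 : R,
  [/\ [/\ zero_or_unit t0, zero_or_unit t1, zero_or_unit t2 & zero_or_unit t3],
      has (predC1 0) [:: t0; t1; t2; t3] &
      t0 * e0 + t1 * e1 + t2 * e2 + t3 * e3 = 0].
Proof.
pose t (z z' : int) : R := z%:~R + r *~ z'.
have tM z z' y : t z z' * y = y *~ z + (r * y) *~ z'.
  by rewrite mulrDl mulrzl mulrzAl.
have t_unit z z' : small p z -> small p z' -> ~~ ((z == 0) && (z' == 0)) ->
    exists u, u * t z z' = 1.
  move=> sz sz' zz'; have [nt|[u ut _]] := locR (t z z'); last by exists u.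
  have [z'0|z'0] := eqVneq z' 0.
    rewrite z'0 eqxx andbT in zz'.
    have [u uz] := coprime_int_inv p_pr pk0 sz zz'.
    case: (@not_nilp1 R); rewrite -uz intrM.
    by move: nt; rewrite /t z'0 mulr0z addr0; apply: local_nilpMl.
  have [u uz] := coprime_int_inv p_pr pk0 sz' z'0.
  case: (r_gen (z := - (u * z))).
  have -> : r - (- (u * z))%:~R = u%:~R * t z z'; last exact: local_nilpMl.
  rewrite mulrDr -intrM rmorphN opprK addrC; congr (_ + _).
  by rewrite mulrzAr mulrzl -mulrzA -[LHS]mulr1 -uz mulrzr.
have t_coef z z' : small p z -> small p z' -> zero_or_unit (t z z').
  move=> sz sz'; case: (boolP ((z == 0) && (z' == 0))) => [|zz'].
    by case/andP=> /eqP-> /eqP->; left; rewrite /t !mulr0z addr0.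
  by right; apply: t_unit.
have t_nz z z' : small p z -> small p z' -> t z z' == 0 ->
    (z == 0) && (z' == 0).
  move=> sz sz' /eqP t0; apply: contraT => /(t_unit _ _ sz sz')[u].
  by rewrite t0 mulr0 => /eqP; rewrite eq_sym oner_eq0.
have [z0 [z1 [z2 [z3 [z4 [z5 [z6 [z7 [S N E]]]]]]]]] :=
  dep e0 (r * e0) e1 (r * e1) e2 (r * e2) e3 (r * e3).
case/and5P: S => s0 s1 s2 s3 /and5P[s4 s5 s6 s7 _].
exists (t z0 z1), (t z2 z3), (t z4 z5), (t z6 z7); split.
- by split; apply: t_coef.
- apply: contraLR N; rewrite -!all_predC /= !negbK => /and5P[].
  move=> /(t_nz _ _ s0 s1)/andP[-> ->] /(t_nz _ _ s2 s3)/andP[-> ->].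
  by move=> /(t_nz _ _ s4 s5)/andP[-> ->] /(t_nz _ _ s6 s7)/andP[-> ->].
- by rewrite !tM !addrA.
Qed.

Lemma large_residue_field_reversible : reversible_ring R.
Proof.
move=> a b ab; apply/eqP/negPn/negP => /eqP ba.
have [na nb] := zero_divisor_nilp locR ab ba.
have a_nz : a <> 0 by move=> a0; case: ba; rewrite a0 mulr0.
have b_nz : b <> 0 by move=> b0; case: ba; rewrite b0 mul0r.
have unit_term t j y : zero_or_unit t -> nilp j ->
    y <> 0 -> t * y + j * y = 0 -> t = 0.
  move=> [//|[u ut]] nj y_nz E; case: y_nz.
  by apply: (unit_add_nilp_regular ut _ E); apply: local_nilpMl.
have last_term t y : zero_or_unit t -> y <> 0 -> t * y = 0 -> t = 0.
  move=> tP y_nz E; apply: (unit_term t 0 y tP _ y_nz).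
    by exists 1%N; rewrite expr1.
  by rewrite mul0r addr0.
(* otherwise 1, a, b, b a would be independent *)
have [w bE] : exists w, b = w * a.
  have [t0 [t1 [t2 [t3 [[T0 T1 T2 T3] N E]]]]] := dependent4 1 a b (b * a).
  have t00 : t0 = 0.
    apply: (unit_term t0 (t2 * b) b T0 _ b_nz); first exact: local_nilpMl.
    have := congr1 (fun v => v * b) E.
    by rewrite mul0r !mulrDl -!mulrA ab !mulr0 mul1r !addr0.
  rewrite t00 mul0r add0r in E; case: T2 => [t20|[u ut]].
    rewrite t20 mul0r addr0 in E.
    have t10 : t1 = 0.
      apply: (unit_term t1 (t3 * b) a T1 _ a_nz); first exact: local_nilpMl.
      by rewrite -mulrA.
    rewrite t10 mul0r add0r in E.
    by move: N; rewrite /= t00 t10 t20 (last_term _ _ T3 ba E) /= eqxx.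
  exists (- u * (t1 + t3 * b)).
  have := congr1 (fun v => u * v) E.
  rewrite mulr0 addrAC mulrDr [u * (t2 * b)]mulrA ut mul1r => /eqP.
  rewrite [X in X == _]addrC addr_eq0 => /eqP{1}->.
  by rewrite !mulNr !mulrDr mulrDl !mulrA.
have awa : a * (w * a) = 0 by rewrite -bE.
have waa : w * (a * a) <> 0 by move: ba; rewrite bE -mulrA.
have aa_nz : a * a <> 0 by move=> aa0; case: waa; rewrite aa0 mulr0.
(* 1, a, a a, w a a if w is nilpotent; 1, a, a w, a a if w is a unit *)
have [nw|[w' _ ww']] := locR w.
  have [t0 [t1 [t2 [t3 [[T0 T1 T2 T3] N E]]]]] :=
    dependent4 1 a (a * a) (w * (a * a)).
  have t00 : t0 = 0.
    apply: (unit_term t0 ((t1 + t2 * a + t3 * (w * a)) * a) a T0 _ a_nz).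
      exact: local_nilpMl.
    have := congr1 (fun v => v * a) E.
    by rewrite mul0r !mulrDl mulr1 -!mulrA !addrA.
  rewrite t00 mul0r add0r in E.
  have t10 : t1 = 0.
    apply: (unit_term t1 ((t2 + t3 * w) * a) a T1 _ a_nz).
      exact: local_nilpMl.
    by move: E; rewrite !mulrDl -!mulrA !addrA.
  rewrite t10 mul0r add0r in E.
  have t20 : t2 = 0.
    apply: (unit_term t2 (t3 * w) (a * a) T2 _ aa_nz).
      exact: local_nilpMl.
    by move: E; rewrite -!mulrA.
  rewrite t20 mul0r add0r in E.
  by move: N; rewrite /= t00 t10 t20 (last_term _ _ T3 waa E) /= eqxx.
have [t0 [t1 [t2 [t3 [[T0 T1 T2 T3] N E]]]]] := dependent4 1 a (a * w) (a * a).
have t00 : t0 = 0.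
  apply: (unit_term t0 ((t1 + t3 * a) * a) a T0 _ a_nz).
    exact: local_nilpMl.
  have := congr1 (fun v => v * a) E.
  by rewrite mul0r !mulrDl mulr1 -!mulrA awa mulr0 addr0 !addrA.
rewrite t00 mul0r add0r in E.
have t10 : t1 = 0.
  apply: (unit_term t1 (t3 * a) (a * a) T1 _ aa_nz).
    exact: local_nilpMl.
  have := congr1 (fun v => v * a) E.
  by rewrite mul0r !mulrDl -!mulrA awa mulr0 addr0.
rewrite t10 mul0r add0r in E.
have t20 : t2 = 0.
  case: T2 => [//|[u ut]]; case: a_nz.
  apply: (@nilp_sandwich_eq0 _ (- (u * t3) * a) w' a).
    exact: local_nilpMl.
  have := congr1 (fun v => u * v * w') E.
  rewrite mulr0 mul0r mulrDr mulrDl mulrA ut mul1r -[a * w * w']mulrA ww' mulr1.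
  by move/eqP; rewrite addr_eq0 => /eqP{1}->; rewrite !mulNr !mulrA.
rewrite t20 mul0r add0r in E.
by move: N; rewrite /= t00 t10 t20 (last_term _ _ T3 aa_nz E) /= eqxx.
Qed.

End LargeResidueField.

(** * Triples with cyclic socle products *)

Definition socle (R : nzRingType) (s : R) : Prop :=
  forall x : R, nilp x -> x * s = 0 /\ s * x = 0.

(** The model is the ring of dimension eight over F_p with basis 1, a, b, c, b a,
    a c, c b, a c b, where a c b = b a c = c b a and the other products of
    two generators vanish: it is reflexive and not reversible, so the bound p ^ 8
    on the order is sharp. *)
Record cyclic_triple (R : nzRingType) (a b c : R) : Prop := CyclicTriple {
  ct_nilp : [/\ nilp a, nilp b & nilp c];
  ct_ab : a * b = 0;
  ct_bJa : forall x, nilp x -> b * x * a = 0;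
  ct_aJcb : forall x, nilp x -> a * (x * c) * b = 0;
  ct_acJb : forall x, nilp x -> a * (c * x) * b = 0;
  ct_acb : a * c * b <> 0 /\ socle (a * c * b);
  ct_bac : b * a * c <> 0 /\ socle (b * a * c);
  ct_cba : c * b * a <> 0 /\ socle (c * b * a)
}.

(** Reversing words and exchanging a and b fixes the word a c b, exchanges b a c
    with c b a, and exchanges the conditions on a J c b and a c J b. *)
Lemma cyclic_triple_converse (R : nzRingType) (a b c : R) :
  cyclic_triple a b c -> cyclic_triple (b : R^c) a c.
Proof.
have soc (s : R) : socle s -> socle (s : R^c).
  by move=> sS x /nilp_converse /sS[].
case=> -[na nb nc] ab bJa aJcb acJb [acb acbS] [bac bacS] [cba cbaS].
split.
- by split; apply/nilp_converse.
- exact: ab.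
- by move=> x /nilp_converse /bJa; rewrite -mulrA.
- by move=> x /nilp_converse /acJb; rewrite -mulrA.
- by move=> x /nilp_converse /aJcb; rewrite -mulrA.
- by rewrite -[_ * _]/(a * (c * b)) mulrA; split=> //; apply: soc.
- by rewrite -[_ * _]/(c * (b * a)) mulrA; split=> //; apply: soc.
- by rewrite -[_ * _]/(b * (a * c)) mulrA; split=> //; apply: soc.
Qed.

Section Triple.

Variables (p : nat) (R : nzRingType).
Hypothesis reg : small_regular p R.
Hypothesis dep : dependent8 p R.

Lemma coef0 (x : R) z : x <> 0 -> small p z -> x *~ z = 0 -> z = 0.
Proof. by move=> x0 sz xz; apply/eqP/negPn/negP => /reg-/(_ x sz xz). Qed.

(** The element z + t c is a unit plus a nilpotent element. *)
Lemma int_add_nilp_regular (c y : R) z t :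
  nilp c -> small p z -> z != 0 -> y *~ z + (c * y) *~ t = 0 -> y = 0.
Proof.
move=> [n cn] sz z0 E.
have {cn}: c ^+ n * y = 0 by rewrite cn mul0r.
elim: n => [|n IHn]; first by rewrite mul1r.
move=> cy; apply: IHn; apply: (reg sz z0).
have := congr1 (fun v => c ^+ n * v) E.
by rewrite /= mulr0 mulrDr !mulrzAr mulrA -exprSr cy mul0rz addr0.
Qed.

Section Relations.

Variables a b c : R.
Hypothesis abc : cyclic_triple a b c.

Let na : nilp a. Proof. by case: (ct_nilp abc). Qed.
Let nb : nilp b. Proof. by case: (ct_nilp abc). Qed.
Let nc : nilp c. Proof. by case: (ct_nilp abc). Qed.

Let ab0 : a * b = 0. Proof. exact: ct_ab abc. Qed.
Let bxa0 x : nilp x -> b * (x * a) = 0.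
Proof. by rewrite mulrA; apply: ct_bJa abc x. Qed.
Let accb0 : a * (c * (c * b)) = 0.
Proof. by have := ct_acJb abc nc; rewrite -!mulrA. Qed.
Let acb_nz : a * (c * b) <> 0.
Proof. by case: (ct_acb abc); rewrite -!mulrA. Qed.
Let bac_nz : b * (a * c) <> 0.
Proof. by case: (ct_bac abc); rewrite -!mulrA. Qed.
Let cba_nz : c * (b * a) <> 0.
Proof. by case: (ct_cba abc); rewrite -!mulrA. Qed.

Let xacb x : nilp x -> x * (a * (c * b)) = 0.
Proof. by case: (ct_acb abc) => _ S /S[]; rewrite -!mulrA. Qed.
Let xbac x : nilp x -> x * (b * (a * c)) = 0.
Proof. by case: (ct_bac abc) => _ S /S[]; rewrite -!mulrA. Qed.
Let xcba x : nilp x -> x * (c * (b * a)) = 0.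
Proof. by case: (ct_cba abc) => _ S /S[]; rewrite -!mulrA. Qed.
Let acbx x : nilp x -> a * (c * (b * x)) = 0.
Proof. by case: (ct_acb abc) => _ S /S[]; rewrite -!mulrA. Qed.
Let bacx x : nilp x -> b * (a * (c * x)) = 0.
Proof. by case: (ct_bac abc) => _ S /S[]; rewrite -!mulrA. Qed.
Let cbax x : nilp x -> c * (b * (a * x)) = 0.
Proof. by case: (ct_cba abc) => _ S /S[]; rewrite -!mulrA. Qed.

Let tail2 (u v : R) : u * v = 0 -> forall y, u * (v * y) = 0.
Proof. by move=> uv y; rewrite mulrA uv mul0r. Qed.
Let tail3 (u v w : R) :
  u * (v * w) = 0 -> forall y, u * (v * (w * y)) = 0.
Proof. by move=> uvw y; rewrite (mulrA v) mulrA uvw mul0r. Qed.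
Let tail4 (u v w x : R) :
  u * (v * (w * x)) = 0 -> forall y, u * (v * (w * (x * y))) = 0.
Proof. by move=> uvw y; rewrite (mulrA w) (mulrA v) mulrA uvw mul0r. Qed.

(** Rewriting rules for words nested to the right: the words in a, b, c that
    vanish, each as a whole word and as a prefix of a longer one. *)
Let monomials0 :=
  (ab0, tail2 ab0,
   bxa0 na, tail3 (bxa0 na), bxa0 nb, tail3 (bxa0 nb),
   bxa0 nc, tail3 (bxa0 nc), accb0, tail4 accb0,
   (xacb na, xacb nb, xacb nc, xbac na, xbac nb, xbac nc,
    xcba na, xcba nb, xcba nc),
   (acbx na, acbx nb, acbx nc, bacx na, bacx nb, bacx nc,
    cbax na, cbax nb, cbax nc),
   (tail4 (acbx na), tail4 (acbx nb), tail4 (acbx nc),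
    tail4 (bacx na), tail4 (bacx nb), tail4 (bacx nc),
    tail4 (cbax na), tail4 (cbax nb), tail4 (cbax nc))).

(** [sandwich E u v F] multiplies the relation E by u on the left and v on the
    right and drops the vanishing terms; the result is F. *)
Local Ltac sandwich E u v F :=
  have F := congr1 (fun w => u * w * v) E;
  rewrite /= ?mulr1 ?mul1r ?mulr0 ?mul0r ?mulrDr ?mulrDl ?mulrzAr ?mulrzAl
    ?mulr1 ?mul1r -?mulrA ?monomials0 ?mulr0 ?mul0rz ?add0r ?addr0 in F.

(** Multiplying by b on the right gives (beta + zeta c) b b = - epsilon a c b, so
    c b b = 0; similarly c b c b = 0, and then multiplying by c b on the left
    shows alpha = 0. Now b is a combination of longer words, in which a c must
    occur because a c b is not 0; so c a takes the place of b among the eight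
    elements, and a c a c plays the part of a c b. *)
Lemma relation_involving_b alpha beta delta epsilon zeta eta :
  small p alpha -> small p beta -> small p epsilon -> beta != 0 ->
  a *~ alpha + b *~ beta + (b * a) *~ delta + (a * c) *~ epsilon +
    (c * b) *~ zeta + (a * (c * b)) *~ eta = 0 -> False.
Proof.
move=> sal sbe sep be0 E.
have regc := int_add_nilp_regular nc sbe be0.
have cbb : c * (b * b) = 0.
  by sandwich E c b F; apply: regc F.
have cbcb : c * (b * (c * b)) = 0.
  by sandwich E c (c * b) F; apply: regc F.
have al0 : alpha = 0.
  sandwich E (c * b) (1 : R) F; apply: (coef0 cba_nz sal).
  by move: F; rewrite cbb cbcb !mul0rz !addr0.
subst alpha; rewrite mulr0z add0r in E.
sandwich E (a * c) (1 : R) acac.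
have acac_nz : a * (c * (a * c)) <> 0.
  move=> acac0; apply: acb_nz; apply: (reg sbe be0); move: acac.
  by rewrite acac0 mul0rz addr0.
have ep0 : epsilon != 0.
  apply/eqP => ep0; apply: acb_nz; apply: (reg sbe be0); move: acac.
  by rewrite ep0 mulr0z addr0.
have caac : c * (a * (a * c)) = 0.
  by sandwich E (c * a) (1 : R) F; apply: (reg sep ep0).
have [z0 [z1 [z2 [z3 [z4 [z5 [z6 [z7 [S N {}E]]]]]]]]] :=
  dep 1 c a (a * c) (c * a) (b * a) (c * b) (a * (c * b)).
case/and5P: S => s0 s1 s2 s3 /and5P[s4 s5 s6 s7 _].
sandwich E (1 : R) (a * (c * b)) F; have {F}? := coef0 acb_nz s0 F; subst z0.
sandwich E a b F; have {F}? := coef0 acb_nz s1 F; subst z1.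
rewrite !mulr0z !add0r in E.
sandwich E (1 : R) (c * b) F; rewrite cbcb mul0rz addr0 in F.
have {F}? := coef0 acb_nz s2 F; subst z2; rewrite mulr0z add0r in E.
sandwich E (1 : R) (a * c) F; rewrite caac mul0rz addr0 in F.
have {F}? := coef0 acac_nz s3 F; subst z3.
rewrite !mulr0z !add0r in E.
sandwich E a c F; have {F}? := coef0 acac_nz s4 F; subst z4.
rewrite !mulr0z !add0r in E.
sandwich E a (1 : R) F; have {F}? := coef0 acb_nz s6 F; subst z6.
rewrite !mulr0z !addr0 in E.
sandwich E c (1 : R) F; have {F}? := coef0 cba_nz s5 F; subst z5.
rewrite !mulr0z !add0r in E.
by have := coef0 acb_nz s7 E => z70; subst z7.
Qed.

(** Multiplying the relation by a, by b and by c shows that epsilon and zeta are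
    not 0, and that a a c and c b b are nonzero multiples of a c b and b c b is
    one of b a c. Since b c b <> 0, the product b c is a new element, which takes
    the place of a c. *)
Lemma relation_of_products delta epsilon zeta eta :
  all (small p) [:: delta; epsilon; zeta; eta] ->
  has (predC1 0) [:: delta; epsilon; zeta; eta] ->
  (b * a) *~ delta + (a * c) *~ epsilon + (c * b) *~ zeta +
    (a * (c * b)) *~ eta = 0 -> False.
Proof.
case/and5P=> sde sep sze seta _ N E.
sandwich E a (1 : R) aac.
sandwich E (1 : R) b cbb.
have ep0 : epsilon != 0.
  apply/eqP => ep0; subst epsilon.
  rewrite mulr0z add0r in aac.
  have ze0 := coef0 acb_nz sze aac; subst zeta.
  sandwich E c (1 : R) F.
  have {F}? := coef0 cba_nz sde F; subst delta.
  rewrite !mulr0z !add0r in E.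
  by have eta0 := coef0 acb_nz seta E; subst eta.
have ze0 : zeta != 0.
  apply/eqP => ze0; apply: acb_nz; apply: (reg sep ep0); move: cbb.
  by rewrite ze0 mulr0z addr0.
have aac_nz : a * (a * c) <> 0.
  move=> aac0; apply: acb_nz; apply: (reg sze ze0); move: aac.
  by rewrite aac0 mul0rz add0r.
have cbb_nz : c * (b * b) <> 0.
  move=> cbb0; apply: acb_nz; apply: (reg sep ep0); move: cbb.
  by rewrite cbb0 mul0rz addr0.
have ccbb : c * (c * (b * b)) = 0.
  by sandwich E c b F; apply: (reg sze ze0).
sandwich E b (1 : R) bcb.
have bcb_nz : b * (c * b) <> 0.
  move=> bcb0; apply: bac_nz; apply: (reg sep ep0); move: bcb.
  by rewrite bcb0 mul0rz addr0.
have cbcb : c * (b * (c * b)) = 0.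
  by sandwich E (c * b) (1 : R) F; apply: (reg sze ze0).
have [z0 [z1 [z2 [z3 [z4 [z5 [z6 [z7 [S {}N {}E]]]]]]]]] :=
  dep 1 c a b (c * b) (b * a) (b * c) (a * (c * b)).
case/and5P: S => s0 s1 s2 s3 /and5P[s4 s5 s6 s7 _].
sandwich E (1 : R) (a * (c * b)) F; have {F}? := coef0 acb_nz s0 F; subst z0.
sandwich E a b F; have {F}? := coef0 acb_nz s1 F; subst z1.
rewrite !mulr0z !add0r in E.
sandwich E a c F; have {F}? := coef0 aac_nz s2 F; subst z2.
rewrite !mulr0z !add0r in E.
sandwich E c b F; rewrite ccbb cbcb !mul0rz !addr0 in F.
have {F}? := coef0 cbb_nz s3 F; subst z3.
rewrite !mulr0z !add0r in E.
sandwich E a (1 : R) F; have {F}? := coef0 acb_nz s4 F; subst z4.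
rewrite !mulr0z !add0r in E.
sandwich E (1 : R) b F; have {F}? := coef0 bcb_nz s6 F; subst z6.
rewrite !mulr0z !addr0 in E.
sandwich E c (1 : R) F; have {F}? := coef0 cba_nz s5 F; subst z5.
rewrite !mulr0z !add0r in E.
by have := coef0 acb_nz s7 E => z70; subst z7.
Qed.

(** The coefficient of 1 vanishes on multiplying by the socle element a c b, and
    that of c on multiplying by a on the left and b on the right. *)
Lemma triple_relation :
  exists alpha beta delta epsilon zeta eta : int,
  [/\ all (small p) [:: alpha; beta; delta; epsilon; zeta; eta],
      has (predC1 0) [:: alpha; beta; delta; epsilon; zeta; eta] &
      a *~ alpha + b *~ beta + (b * a) *~ delta + (a * c) *~ epsilon +
        (c * b) *~ zeta + (a * (c * b)) *~ eta = 0].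
Proof.
have [z0 [z1 [z2 [z3 [z4 [z5 [z6 [z7 [S N E]]]]]]]]] :=
  dep 1 c a b (b * a) (a * c) (c * b) (a * (c * b)).
case/and3P: S => s0 s1 S.
sandwich E (1 : R) (a * (c * b)) F; have {F}? := coef0 acb_nz s0 F; subst z0.
sandwich E a b F; have {F}? := coef0 acb_nz s1 F; subst z1.
by exists z2, z3, z4, z5, z6, z7; rewrite !mulr0z !add0r in E; split.
Qed.

End Relations.
End Triple.

Lemma no_cyclic_triple p (R : nzRingType) (a b c : R) :
  small_regular p R -> dependent8 p R -> ~ cyclic_triple a b c.
Proof.
move=> reg dep abc.
have [al [be [de [ep [ze [eta [S N E]]]]]]] := triple_relation reg dep abc.
case/and3P: (S) => sal sbe /and5P[_ sep sze _ _].
have [be0|] := eqVneq be 0; last first.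
  by move=> be_nz; apply: (relation_involving_b reg dep abc sal sbe sep be_nz E).
have [al0|al_nz] := eqVneq al 0.
  subst al be; rewrite !mulr0z !add0r in E.
  by case/and3P: S => _ _ S; apply: (relation_of_products reg dep abc S N E).
apply: (@relation_involving_b p R^c reg dep b a c (cyclic_triple_converse abc)
  be al de ze ep eta sbe sal sze al_nz).
(* the relation E, its terms in the order of the converse ring *)
rewrite -[RHS]E.
rewrite [X in X + _ *~ de + _]addrC -!addrA.
do 3 congr (_ + _); rewrite addrCA; do 2 congr (_ + _).
by rewrite -[in LHS]/(a * c * b) mulrA.
Qed.

(** * Triples in reflexive local rings *)

Section Triples.

Variable R : finNzRingType.
Hypothesis locR : local_ring R.
Hypothesis reflR : reflexive_ring R.
Hypothesis resR : forall r : R, exists z : int, nilp (r - z%:~R).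
Implicit Types a b c x y : R.

Let size_of c := #|[set u.1 * c * u.2 | u : R * R]|.

(** If size_of did not decrease, c would be u x c y v for some u and v, and a
    nilpotent x or y would force c = 0. *)
Let size_ofM c x y : c <> 0 -> nilp x \/ nilp y ->
  (size_of (x * c * y)%R < size_of c)%N.
Proof.
move=> c_nz nxy; apply: proper_card; apply/properP; split.
  apply/subsetP => _ /imsetP[[u v] _ ->] /=; apply/imsetP.
  by exists (u * x, y * v) => //=; rewrite !mulrA.
exists c.
  by apply/imsetP; exists (1, 1) => //=; rewrite mul1r mulr1.
apply/imsetP => -[[u v] _ /= E]; case: c_nz.
have {}E : c = (u * x) * c * (y * v) by rewrite [LHS]E !mulrA.
case: nxy => [nx|ny].
  by apply: nilp_sandwich_eq0 E; apply: local_nilpMl.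
by apply: nilp_sandwich_eq0r E; apply: local_nilpMr.
Qed.

(** The number of products u c v measures how deep c lies in the radical. *)
Let deepest (P : pred R) c0 : P c0 -> ~~ P 0 ->
  exists2 c, P c & forall x y, nilp x \/ nilp y -> ~~ P (x * c * y).
Proof.
move=> Pc0 P0; case: (arg_minnP size_of Pc0) => c Pc cmin.
exists c => // x y nxy; apply/negP => /cmin; rewrite leqNgt => /negP; apply.
by apply: size_ofM => // c0'; rewrite -c0' Pc in P0.
Qed.

(** Reflexivity, applied to products of ideals, moves a vanishing product around:
    b J a = 0 gives J a R b = 0 = a R b J, so a c b is in the socle; and
    b R a c = 0 would give a c R b = 0, whence b a c <> 0 as b R a c is spanned
    by b a c. *)
Lemma nonreversible_cyclic_triple a b0 : a * b0 = 0 -> b0 * a <> 0 ->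
  exists b c, cyclic_triple a b c.
Proof.
move=> ab0 b0a.
have [||b /andP[/eqP ab /eqP ba] bmin] :=
  @deepest (fun b => (a * b == 0) && (b * a != 0)) b0.
- by rewrite ab0 eqxx; apply/eqP.
- by rewrite mul0r eqxx andbF.
have [na nb] := zero_divisor_nilp locR ab ba.
have bJa x : nilp x -> b * x * a = 0.
  move=> nx; apply/eqP; move: (bmin 1 x (or_intror nx)).
  by rewrite mul1r mulrA ab mul0r eqxx /= negbK.
have JaRb x r : nilp x -> x * a * r * b = 0.
  move=> nx; apply: (reflR (a := b) (b := x * a)) => s.
  by rewrite mulrA -[b * s * x]mulrA bJa //; apply: local_nilpMl.
have aRbJ x r : nilp x -> a * r * (b * x) = 0.
  move=> nx; apply: (reflR (a := b * x) (b := a)) => s.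
  by rewrite -[b * x * s]mulrA bJa //; apply: local_nilpMr.
have [r0 ar0b] : exists r, a * r * b != 0.
  apply/existsP; apply: contraT => /existsPn arb.
  by case: ba; rewrite -[b]mulr1; apply: reflR => r; apply/eqP/negPn/arb.
have [||c acb cmin] := @deepest (fun c => a * c * b != 0) r0 => //.
  by rewrite mulr0 mul0r negbK eqxx.
have aJcJb x y : nilp x \/ nilp y -> a * (x * c * y) * b = 0.
  by move=> /cmin/negPn/eqP.
(* c cannot be a unit: r0 - z would be a deeper witness than c *)
have nc : nilp c.
  have [//|[d dc _]] := locR c; have [z nr0] := resR r0.
  case/eqP: ar0b; transitivity (a * (r0 - z%:~R) * b).
    by rewrite mulrBr mulrBl mulrzr mulrzAl ab mul0rz subr0.
  move: (r0 - z%:~R) nr0 => j nj; rewrite -[j]mulr1 -dc [j * _]mulrA.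
  rewrite -[_ * d * c]mulr1.
  by apply: aJcJb; left; apply: local_nilpMr.
have aJcb x : nilp x -> a * (x * c) * b = 0.
  by move=> nx; rewrite -[x * c]mulr1; apply: aJcJb; left.
have acJb x : nilp x -> a * (c * x) * b = 0.
  by move=> nx; rewrite -[c]mul1r; apply: aJcJb; right.
(* J and the integers span R, so u J v and u v control u R v *)
have split_int u v r : (forall x, nilp x -> u * x * v = 0) -> u * v = 0 ->
    u * r * v = 0.
  move=> uJv uv; have [z nz] := resR r.
  rewrite -[r](subrK z%:~R) mulrDr mulrDl uJv // add0r.
  by rewrite mulrzr mulrzAl uv mul0rz.
exists b, c; split=> //.
- split; first exact/eqP.
  move=> x nx; split.
    by rewrite !mulrA JaRb.
  by rewrite -mulrA aRbJ.
- split.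
    move=> bac; case/eqP: acb; rewrite -[a * c]mulr1.
    apply: (reflR (a := b)) => r; apply: split_int; last by rewrite mulrA.
    by move=> x nx; rewrite mulrA bJa // mul0r.
  move=> x nx; split.
    rewrite -mulrA mulrA -[x * b]mulr1; apply: (reflR (a := a * c)) => r.
    by rewrite -!mulrA (mulrA r) (mulrA c) mulrA acJb //; apply: local_nilpMl.
  rewrite -mulrA -[b]mulr1 -mulrA -mulrA.
  rewrite mulrA (mulrA a); apply: (reflR (a := a * c * x)) => r.
  by rewrite -[a * c * x * r]mulrA -[a * c * _]mulrA acJb //; apply: local_nilpMr.
- split.
    move=> cba; case/eqP: acb; rewrite -[a]mulr1 -[a * 1 * c * b]mulrA.
    apply: (reflR (a := c * b)) => r; apply: split_int => //.
    by move=> x nx; rewrite -!mulrA (mulrA b) bJa ?mulr0.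
  move=> x nx; split.
    rewrite mulrA -[x * (c * b)]mulr1; apply: (reflR (a := a)) => r.
    by rewrite !mulrA -(mulrA a r) -(mulrA a) aJcb //; apply: local_nilpMl.
  rewrite -(mulrA (c * b)) -[c * b]mulr1; apply: (reflR (a := a * x)) => r.
  by rewrite mulrA -(mulrA a x) -(mulrA a) aJcb //; apply: local_nilpMr.
Qed.

End Triples.

(** * Corner rings of central idempotents *)

Record central_idempotent (R : nzRingType) (e : R) : Prop := CentralIdempotent {
  ci_idem : e * e = e;
  ci_central : forall x : R, e * x = x * e;
  ci_neq0 : e <> 0
}.

(** The ring e R, with identity e. The proof [eP] is an argument of the type so
    that the ring structure can be inferred from it. *)
Definition corner (R : finNzRingType) (e : R) (eP : central_idempotent e) :=
  {x : R | e * x == x}.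

Section Corner.

Variables (R : finNzRingType) (e : R) (eP : central_idempotent e).
Local Notation eR := (corner eP).

HB.instance Definition _ := Finite.on eR.
HB.instance Definition _ := SubType.on eR.

Fact corner_subproof (x : R) : e * (e * x) == e * x.
Proof. by rewrite mulrA (ci_idem eP). Qed.

Definition to_corner (x : R) : eR := exist _ (e * x) (corner_subproof x).

Lemma val_to_corner x : val (to_corner x) = e * x. Proof. by []. Qed.

Lemma corner_id (x : eR) : e * val x = val x.
Proof. exact/eqP/(valP x). Qed.

Definition corner_add (x y : eR) := to_corner (val x + val y).
Definition corner_opp (x : eR) := to_corner (- val x).
Definition corner_mul (x y : eR) := to_corner (val x * val y).

Lemma val_corner_add x y : val (corner_add x y) = val x + val y.
Proof. by rewrite val_to_corner mulrDr !corner_id. Qed.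
Lemma val_corner_opp x : val (corner_opp x) = - val x.
Proof. by rewrite val_to_corner mulrN corner_id. Qed.
Lemma val_corner_mul x y : val (corner_mul x y) = val x * val y.
Proof. by rewrite val_to_corner mulrA corner_id. Qed.

Definition cornerE :=
  (val_to_corner, val_corner_add, val_corner_opp, val_corner_mul).

Fact corner_addA : associative corner_add.
Proof. by move=> x y z; apply: val_inj; rewrite !cornerE addrA. Qed.
Fact corner_addC : commutative corner_add.
Proof. by move=> x y; apply: val_inj; rewrite !cornerE addrC. Qed.
Fact corner_add0 : left_id (to_corner 0) corner_add.
Proof. by move=> x; apply: val_inj; rewrite !cornerE mulr0 add0r. Qed.
Fact corner_addN : left_inverse (to_corner 0) corner_opp corner_add.
Proof. by move=> x; apply: val_inj; rewrite !cornerE mulr0 addNr. Qed.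

HB.instance Definition _ :=
  GRing.isZmodule.Build eR corner_addA corner_addC corner_add0 corner_addN.

Lemma val_cornerD (x y : eR) : val (x + y) = val x + val y.
Proof. exact: val_corner_add. Qed.

Fact corner_mulA : associative corner_mul.
Proof. by move=> x y z; apply: val_inj; rewrite !cornerE mulrA. Qed.
Fact corner_mul1 : left_id (to_corner 1) corner_mul.
Proof. by move=> x; apply: val_inj; rewrite !cornerE mulr1 corner_id. Qed.
Fact corner_mulr1 : right_id (to_corner 1) corner_mul.
Proof.
move=> x; apply: val_inj; rewrite !cornerE mulr1.
by rewrite -(ci_central eP) corner_id.
Qed.
Fact corner_mulDl : left_distributive corner_mul (@GRing.add eR).
Proof.
by move=> x y z; apply: val_inj; rewrite !(val_corner_mul, val_cornerD) mulrDl.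
Qed.
Fact corner_mulDr : right_distributive corner_mul (@GRing.add eR).
Proof.
by move=> x y z; apply: val_inj; rewrite !(val_corner_mul, val_cornerD) mulrDr.
Qed.
Fact corner_1neq0 : to_corner 1 != 0 :> eR.
Proof.
apply/eqP => /(congr1 val); rewrite !cornerE mulr1 mulr0.
exact: ci_neq0 eP.
Qed.

HB.instance Definition _ := GRing.Zmodule_isNzRing.Build eR
  corner_mulA corner_mul1 corner_mulr1 corner_mulDl corner_mulDr corner_1neq0.

Lemma val_cornerM (x y : eR) : val (x * y) = val x * val y.
Proof. exact: val_corner_mul. Qed.

Lemma val_corner0 : val (0 : eR) = 0.
Proof. exact: mulr0. Qed.

Lemma val_cornerMn (n : nat) : val (n%:R : eR) = e *+ n.
Proof.
elim: n => [|n IHn]; first exact: val_corner0.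
by rewrite !mulrSr -IHn val_cornerD [val (1 : eR)]mulr1.
Qed.

Lemma card_corner_lt : e <> 1 -> (#|(eR : finNzRingType)| < #|R|)%N.
Proof.
move=> e1; rewrite -(card_imset _ (@val_inj _ _ eR)).
apply/proper_card/properP; split; first exact/subsetP.
exists 1 => //; apply/imsetP => -[x _ E]; case: e1.
by rewrite -[e]mulr1 E corner_id.
Qed.

Lemma corner_abelian : abelian_ring R -> abelian_ring eR.
Proof.
move=> abR f ff x; apply: val_inj; rewrite !val_cornerM.
by apply: abR; rewrite -val_cornerM ff.
Qed.

Lemma corner_reflexive : reflexive_ring R -> reflexive_ring eR.
Proof.
move=> reflR x y xy r; apply: val_inj; rewrite !val_cornerM val_corner0.
apply: reflR => s; rewrite -(corner_id y) mulrA -[_ * s * e]mulrA.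
rewrite -(ci_central eP) -[e * s]/(val (to_corner s)) -!val_cornerM.
by rewrite xy val_corner0.
Qed.

Lemma corner_reversible (a b : R) :
  reversible_ring eR -> a * b = 0 -> e * (b * a) = 0.
Proof.
move=> revR ab.
have mulC x y : val (to_corner x * to_corner y) = e * (x * y).
  rewrite val_cornerM !val_to_corner -mulrA (mulrA x) -(ci_central eP x).
  by rewrite -mulrA mulrA (ci_idem eP).
rewrite -mulC revR ?val_corner0 //; apply: val_inj.
by rewrite mulC ab mulr0 val_corner0.
Qed.

End Corner.

(** * Reduction to local rings *)

(** The two cases are whether each element is congruent to an integer modulo the
    radical; integers smaller than p ^ k suffice, so this is decidable. *)
Lemma local_reflexive_reversible p k (R : finNzRingType) :
  prime p -> (p ^ k)%:R = 0 :> R -> (#|R| < p ^ 8)%N ->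
  local_ring R -> reflexive_ring R -> reversible_ring R.
Proof.
move=> p_pr pk0 cardR locR reflR a b ab.
have dep := card_lt_dependent8 (prime_gt0 p_pr) cardR.
pose unitb (x : R) := [exists y, y * x == 1].
have nilpP (x : R) : reflect (nilp x) (~~ unitb x).
  apply: (iffP negP) => [nu | nx /existsP[y /eqP yx]].
    by have [//|[y yx _]] := locR x; case: nu; apply/existsP; exists y; apply/eqP.
  by apply: (@not_nilp1 R); rewrite -yx; apply: local_nilpMl.
have [resR|] :=
  boolP [forall r : R, exists n : 'I_(p ^ k), ~~ unitb (r - n%:R)].
  apply/eqP/negPn/negP => /eqP ba.
  have {}resR (r : R) : exists z : int, nilp (r - z%:~R).
    by have /existsP[n /nilpP nn] := forallP resR r; exists n%:Z.
  have [b' [c abc]] := nonreversible_cyclic_triple locR reflR resR ab ba.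
  exact: no_cyclic_triple (small_regular_prime_power p_pr pk0) dep abc.
rewrite negb_forall => /existsP[r /existsPn rP].
apply: (large_residue_field_reversible locR p_pr pk0 dep (r := r)) => // z.
have pk_gt0 : (0 < p ^ k)%N by rewrite expn_gt0 prime_gt0.
have pk_nz : (p ^ k)%N%:Z != 0 by rewrite eqz_nat -lt0n.
have := ltz_pmod z (d := (p ^ k)%N) pk_gt0; have := modz_ge0 z pk_nz.
rewrite [X in (r - X%:~R)](divz_eq z (p ^ k)%N); case: (modz _ _) => // m _.
rewrite ltz_nat => mlt /nilpP; apply/negP.
rewrite intrD intrM -(pmulrn 1 (p ^ k)%N) pk0 mulr0 add0r.
exact: rP (Ordinal mlt).
Qed.

(** A nontrivial idempotent e splits R into the corners of e and 1 - e, which are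
    smaller; the hypotheses are stated with p ^ k = 0 and an upper bound for the
    order so that corners inherit them. *)
Lemma finite_reflexive_reversible p k (R : finNzRingType) :
  prime p -> (p ^ k)%:R = 0 :> R -> (#|R| < p ^ 8)%N ->
  abelian_ring R -> reflexive_ring R -> reversible_ring R.
Proof.
move=> p_pr; have [n] := ubnP #|R|; elim: n R => // n IHn R cardRn pk0 cardR.
move=> abR reflR.
have corner_rev (f : R) : f * f = f -> f <> 1 ->
    forall a b, a * b = 0 -> f * (b * a) = 0.
  move=> ff f1 a b ab; have [->|/eqP f0] := eqVneq f 0; first by rewrite mul0r.
  have fP := CentralIdempotent ff (abR f ff) f0.
  have ltR := card_corner_lt fP f1.
  apply: (corner_reversible (eP := fP) _ ab); apply: IHn.
  - exact: leq_trans ltR cardRn.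
  - by apply: val_inj; rewrite val_cornerMn val_corner0 -mulr_natr pk0 mulr0.
  - exact: ltn_trans ltR cardR.
  - exact: corner_abelian.
  - exact: corner_reflexive.
have [/existsP[e /and3P[/eqP ee e0 e1]]|noE] :=
    boolP [exists e : R, [&& e * e == e, e != 0 & e != 1]].
  move=> a b ab.
  rewrite -[b * a]mul1r -(subrK e 1) mulrDl !(corner_rev _ _ _ a b) ?addr0 //.
  - exact/eqP.
  - by rewrite mulrBl mul1r mulrBr mulr1 ee subrr subr0.
  - move/eqP; rewrite subr_eq addrC -subr_eq0 opprD addrCA subrr addr0 oppr_eq0.
    exact/negP.
apply: (local_reflexive_reversible p_pr pk0 cardR _ reflR).
apply: idempotent_trivial_local => e /eqP ee.
move/existsPn: noE => /(_ e); rewrite ee /= -negb_or negbK.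
by case/orP => /eqP; [left | right].
Qed.

Local Close Scope ring_scope.

Theorem theorem1 (p k : nat) (R : finNzRingType) (p_prime : prime p)
    (k_gt0 : 0 < k) (k_lt8 : k < 8) (cardR : #|R| = p ^ k)
    (abR : abelian_ring R) (reflR : reflexive_ring R) :
  reversible_ring R.
Proof.
apply: (@finite_reflexive_reversible p k) => //.
  have /dvdnP[m cardE] := order_dvdG (G := [set: R]%G) (in_setT (1%R : R)).
  rewrite -cardR -cardsT cardE mulnC -FinRing.zmodXgE.
  by rewrite expgM expg_order expg1n.
by rewrite cardR ltn_exp2l // prime_gt1.
Qed.
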